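(* The sequence of operators $\{\mathcal{GK}_n:C[0,\pi]\to C[0,\pi]\}_{n\in\mathbb{N}}$ is uniformly bounded on $C[0,\pi]$; that is, there is a constant $C>0$ such that $\|\mathcal{GK}_n(f)\|_\infty\le C\|f\|_\infty$ for all $n\in\mathbb{N}$ and all $f\in C[0,\pi]$, where $\|\cdot\|_\infty$ is the sup-norm on $[0,\pi]$.
   Context: For $n\in\mathbb{N}$ and $k=1,\dots,n$ let $\theta_k^{(n)}=\frac{(2k-1)\pi}{2n}$ and, for real $\theta$, let $$P_k(\theta)=(-1)^{k+1}\frac{\cos(n\theta)\sin\theta_k^{(n)}}{n(\cos\theta-\cos\theta_k^{(n)})}$$ (the dependence on $n$ is suppressed; $P_k$ is extended by continuity at the removable singularities, so it is a polynomial in $\cos\theta$, namely the fundamental Lagrange polynomial at the Chebyshev nodes $\cos\theta_k^{(n)}$ evaluated at $\cos\theta$). The Grünwald–Kantorovich operators are defined for integrable $f$ on $[0,\pi]$ and $\theta\in[0,\pi]$ by $$\mathcal{GK}_n(f)(\theta)=\frac{n}{\pi}\sum_{k=1}^n\left(\int_{\theta_k^{(n)}}^{\theta_k^{(n)}+\frac{\pi}{2n}}f(t)\,dt\right)\left\{P_k\left(\theta+\frac{\pi}{2n}\right)+P_k\left(\theta-\frac{\pi}{2n}\right)\right\}.$$ *)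

(* Defs.v *)
From HB Require Import structures.
From mathcomp Require Import all_boot all_order all_algebra.
From mathcomp Require Import all_classical all_reals all_analysis.
Set Implicit Arguments.
Unset Strict Implicit.
Unset Printing Implicit Defensive.
Import Order.TTheory GRing.Theory Num.Theory.
Import numFieldNormedType.Exports.
Local Open Scope classical_set_scope.
Local Open Scope ring_scope.

Definition cheb_angle {R : realType} (n k : nat) : R :=
  (2 * k%:R - 1) * pi / (2 * n%:R).

Definition P_quot {R : realType} (n k : nat) (theta : R) : R :=
  (-1) ^+ k.+1 * (cos (n%:R * theta) * sin (cheb_angle n k)) /
    (n%:R * (cos theta - cos (cheb_angle n k))).

(* The quotient is 0/0 exactly where [cos theta = cos (cheb_angle n k)]; there
   the value is the limit over the punctured neighborhoods of [theta]. *)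
Definition P_fun {R : realType} (n k : nat) (theta : R) : R :=
  if cos theta == cos (cheb_angle n k)
  then lim (P_quot n k t @[t --> theta^'])
  else P_quot n k theta.

(* The intervals of integration all lie in [0, pi], so that for [0 < n] only the
   values of [f] on [0, pi] matter. *)
Definition GK {R : realType} (n : nat) (f : R -> R) (theta : R) : R :=
  n%:R / pi *
  \sum_(1 <= k < n.+1)
    (\int[lebesgue_measure]_(t in
        `[cheb_angle n k, (cheb_angle n k + pi / (2 * n%:R))%R]) f t) *
    (P_fun n k (theta + pi / (2 * n%:R)) + P_fun n k (theta - pi / (2 * n%:R))).

(* Extended-real valued, so that an unbounded function has norm +oo rather than
   the default value of the real-valued [sup]. *)
Definition supnorm {R : realType} (f : R -> R) : \bar R :=
  ereal_sup [set `|f x|%:E | x in `[0, pi]].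

(* Main.v *)
Require Import Defs.
From HB Require Import structures.
From mathcomp Require Import all_boot all_order all_algebra.
From mathcomp Require Import all_classical all_reals all_analysis.
From mathcomp Require Import ring lra zify.
Import Order.TTheory GRing.Theory Num.Theory.
Import numFieldNormedType.Exports.
Local Open Scope classical_set_scope.
Local Open Scope ring_scope.

(* Write h = pi / (2 n) and x_k for the Chebyshev angles. By the
   Christoffel-Darboux formula, P_k is the cosine polynomial
   (2 sum_(j < n) cos (j x_k) cos (j t) - 1) / n, hence continuous, and
   T_k(t) = P_k(t + h) + P_k(t - h) is bounded by 6. Multiplying out the two
   quotients,
     (-1)^k T_k(t) n (cos h - cos (t - x_k)) (cos h - cos (t + x_k))
       = 2 sin x_k sin (n t) sin t sin h,
   so for fixed t in [0, pi] the numbers (-1)^k T_k(t) all have the sign of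
   sin (n t), except for the at most two k with |t - x_k| <= h. Therefore
   sum_k |T_k(t)| is at most |sum_k (-1)^k T_k(t)| plus a constant, and the
   alternating sum is computed in closed form and bounded by 6. No pointwise
   decay estimate for T_k is needed. *)

(** * Lagrange polynomials at the Chebyshev nodes *)

Definition lagrange_kernel {R : realType} (n : nat) (x t : R) : R :=
  (2 * (\sum_(j < n) cos (j%:R * x) * cos (j%:R * t)) - 1) / n%:R.

(** Induction by the recurrence cos ((n + 1) t) + cos ((n - 1) t) = 2 cos t cos (n t). Writing (n -
    1) t as [n%:R * t - t] lets it start at [n = 0]. *)
Lemma christoffel_darboux_cos (R : realType) (n : nat) (x t : R) :
  (cos t - cos x) * (2 * (\sum_(j < n) cos (j%:R * x) * cos (j%:R * t)) - 1) =
  cos (n%:R * t) * cos (n%:R * x - x) - cos (n%:R * x) * cos (n%:R * t - t).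
Proof.
elim: n => [|n IHn]; first by rewrite big_ord0 !mul0r !sub0r !cosN cos0; ring.
rewrite big_ord_recr /= [2 * _]mulrDr addrAC [LHS]mulrDr IHn -[n.+1%:R]natr1.
rewrite ![(_ + 1) * _]mulrDl !mul1r !addrK.
rewrite !cosB !cosD; ring.
Qed.

Lemma cos_sin_half_odd_pi (R : realType) (k : nat) :
  cos (k%:R * pi + pi / 2) = 0 :> R /\ sin (k%:R * pi + pi / 2) = (-1) ^+ k :> R.
Proof.
elim: k => [|k [IHc IHs]]; first by rewrite mul0r add0r cos_pihalf sin_pihalf.
have -> : k.+1%:R * pi + pi / 2 = (k%:R * pi + pi / 2) + pi :> R.
  by rewrite -[k.+1%:R]natr1; ring.
by rewrite cosDpi sinDpi IHc IHs oppr0 exprS mulN1r.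
Qed.

Lemma cos_mul_cheb_angle (R : realType) (n k : nat) : (0 < n)%N -> (0 < k)%N ->
  cos (n%:R * cheb_angle n k) = 0 :> R.
Proof.
case: k => // k n0 _; rewrite -[RHS](cos_sin_half_odd_pi R k).1; congr cos.
by rewrite /cheb_angle -[k.+1%:R]natr1; field; rewrite pnatr_eq0 -lt0n.
Qed.

Lemma sin_mul_cheb_angle (R : realType) (n k : nat) : (0 < n)%N -> (0 < k)%N ->
  sin (n%:R * cheb_angle n k) = (-1) ^+ k.+1 :> R.
Proof.
case: k => // k n0 _.
rewrite !exprS !mulN1r opprK -(cos_sin_half_odd_pi R k).2; congr sin.
by rewrite /cheb_angle -[k.+1%:R]natr1; field; rewrite pnatr_eq0 -lt0n.
Qed.

Lemma cheb_angle_itv (R : realType) (n k : nat) : (0 < k <= n)%N ->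
  pi / (2 * n%:R) <= (cheb_angle n k : R) <= pi - pi / (2 * n%:R).
Proof.
move=> /andP[k0 kn]; have n0 : (0 < n%:R :> R) by rewrite ltr0n (leq_trans k0).
have k1 : (1 <= k%:R :> R) by rewrite ler1n.
have kn' : (k%:R <= n%:R :> R) by rewrite ler_nat.
have pi0 := pi_gt0 R.
have -> : pi - pi / (2 * n%:R) = (2 * n%:R - 1) * pi / (2 * n%:R) :> R.
  by field; rewrite gt_eqF.
have q0 : 0 <= (2 * n%:R)^-1 :> R by rewrite invr_ge0; lra.
by rewrite /cheb_angle; apply/andP; split; apply: ler_wpM2r => //; nra.
Qed.

Lemma sin_cheb_angle_gt0 (R : realType) (n k : nat) : (0 < k <= n)%N ->
  0 < sin (cheb_angle n k : R).
Proof.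
move=> kn; have /andP[h1 h2] := cheb_angle_itv R n k kn.
have h0 : 0 < pi / (2 * n%:R) :> R.
  by rewrite divr_gt0 ?pi_gt0// mulr_gt0// ltr0n; case/andP: kn => /leq_trans; exact.
by apply: sin_gt0_pi; rewrite (lt_le_trans h0 h1)/=; lra.
Qed.

(** At a node cos (n x) = 0 and sin (n x) = (-1)^(k + 1), so one term of Christoffel-Darboux
    survives. The form without division covers the removable singularities too. *)
Lemma lagrange_kernelM (R : realType) (n k : nat) (t : R) : (0 < k <= n)%N ->
  lagrange_kernel n (cheb_angle n k) t * (n%:R * (cos t - cos (cheb_angle n k))) =
  (-1) ^+ k.+1 * (cos (n%:R * t) * sin (cheb_angle n k)).
Proof.
move=> /andP[k0 kn]; have n0 := leq_trans k0 kn.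
rewrite /lagrange_kernel mulrA mulfVK ?pnatr_eq0 -?lt0n// mulrC.
rewrite christoffel_darboux_cos cosB.
by rewrite cos_mul_cheb_angle// sin_mul_cheb_angle//; ring.
Qed.

Lemma continuous_lagrange_kernel (R : realType) (n : nat) (x : R) :
  continuous (lagrange_kernel n x).
Proof.
move=> t; apply: cvgMl; apply: cvgB; last exact: cvg_cst.
apply: cvgMr.
apply: cvg_big => [|j _]; first exact: add_continuous.
apply: cvgMr.
apply: (@continuous_comp _ _ _ (fun t : R => j%:R * t) cos).
  by apply: cvgMr; exact: cvg_id.
exact: continuous_cos.
Qed.

(** From cos t - cos x = -2 sin ((t + x) / 2) sin ((t - x) / 2): the first sine tends to sin x, and
    for |t - x| < pi the second vanishes only at [t = x]. *)
Lemma cos_neq_near (R : realType) (x : R) : sin x != 0 ->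
  \forall t \near x^', cos t != cos x.
Proof.
move=> sx.
have half : (fun t : R => sin ((t + x) / 2)) @ x^' --> sin x.
  rewrite -[X in _ --> sin X](_ : (x + x) / 2 = x); last by field.
  apply: cvg_within_filter.
  apply: (@continuous_comp _ _ _ (fun t : R => (t + x) / 2) sin).
    by apply: cvgMl; apply: cvgD; [exact: cvg_id|exact: cvg_cst].
  exact: continuous_sin.
have idx : (fun t : R => t) @ x^' --> x by apply: cvg_within_filter; exact: cvg_id.
near=> t.
have sa : sin ((t + x) / 2) != 0.
  by near: t; apply: (cvgr_neq0 _ half).
have tx : t != x by near: t; exact: nbhs_dnbhs_neq.
have xt : `|x - t| < pi.
  by near: t; apply: (cvgr_dist_lt _ _ idx); exact: pi_gt0.
have sb : sin ((t - x) / 2) != 0.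
  have /orP[lt_tx|lt_xt] : (t < x) || (x < t) by rewrite -neq_lt.
    rewrite -oppr_eq0 -sinN gt_eqF// sin_gt0_pi//.
    by move: xt; rewrite ltr_norml => /andP[_ ?]; apply/andP; split; lra.
  rewrite gt_eqF// sin_gt0_pi//.
  by move: xt; rewrite ltr_norml => /andP[? _]; apply/andP; split; lra.
have -> : cos t = cos ((t + x) / 2 + (t - x) / 2) by congr cos; field.
have -> : cos x = cos ((t + x) / 2 - (t - x) / 2) by congr cos; field.
rewrite cosD cosB -subr_eq0.
have -> : forall a b c d : R, a * b - c * d - (a * b + c * d) = - 2 * (c * d).
  by move=> a b c d; ring.
by rewrite !mulf_neq0// oppr_eq0.
Unshelve. all: by end_near.
Qed.

(** At a singularity the limit is that of the continuous kernel, which agrees with [P_quot] on a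
    punctured neighborhood. *)
Lemma P_funE (R : realType) (n k : nat) (t : R) : (0 < k <= n)%N ->
  P_fun n k t = lagrange_kernel n (cheb_angle n k) t.
Proof.
move=> kn; have n0 : n%:R != 0 :> R.
  by rewrite pnatr_eq0 -lt0n; case/andP: kn => /leq_trans; exact.
have quotE u : cos u != cos (cheb_angle n k : R) ->
    P_quot n k u = lagrange_kernel n (cheb_angle n k) u.
  move=> cu; rewrite /P_quot -lagrange_kernelM// mulfK// mulf_neq0//.
  by rewrite subr_eq0.
rewrite /P_fun; case: eqP => [ct|/eqP]; last exact: quotE.
(* Equal cosines force equal squares of sines, and the sine is positive at a node. *)
have st : sin t != 0.
  apply/negP => /eqP st; have := sin_cheb_angle_gt0 R n k kn.
  have := cos2Dsin2 t; rewrite ct st -(cos2Dsin2 (cheb_angle n k)); nra.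
apply/cvg_lim; first exact: norm_hausdorff.
have /(cvg_trans _) : lagrange_kernel n (cheb_angle n k) @ t^' -->
    lagrange_kernel n (cheb_angle n k) t.
  by apply: cvg_within_filter; exact: continuous_lagrange_kernel.
apply; apply: near_eq_cvg.
apply: filterS (cos_neq_near _ t st) => u; rewrite ct => cu.
by rewrite quotE.
Qed.

(** * The shifted kernels and their alternating sum *)

(** Telescopes, since 2 cos y cos ((2 k - 1) y) = cos (2 k y) + cos (2 (k - 1) y). The factor 2 cos
    y stays on the left because it may vanish. *)
Lemma alternating_sum_cos_odd (R : realType) (m : nat) (y : R) :
  2 * cos y * (\sum_(1 <= k < m.+1) (-1) ^+ k * cos ((2 * k%:R - 1) * y)) =
  (-1) ^+ m * cos (2 * m%:R * y) - 1.
Proof.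
elim: m => [|m IHm].
  by rewrite big_nil !mulr0 mul0r cos0 mulr1 subrr.
rewrite big_nat_recr//= mulrDr IHm -[m.+1%:R]natr1 exprS.
have -> : 2 * m%:R * y = (2 * (m%:R + 1) - 1) * y - y by ring.
have -> : 2 * (m%:R + 1) * y = (2 * (m%:R + 1) - 1) * y + y by ring.
by rewrite cosB cosD; ring.
Qed.

Definition GK_kernel {R : realType} (n k : nat) (t : R) : R :=
  lagrange_kernel n (cheb_angle n k) (t + pi / (2 * n%:R)) +
  lagrange_kernel n (cheb_angle n k) (t - pi / (2 * n%:R)).

(** Adding the shifts by h and -h multiplies frequency j by 2 cos (j h), the factor that
    [alternating_sum_cos_odd] asks for at y = j h. *)
Lemma GK_kernelE (R : realType) (n k : nat) (t : R) :
  GK_kernel n k t =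
  2 / n%:R * (2 * (\sum_(j < n) cos (j%:R * cheb_angle n k) *
    (cos (j%:R * t) * cos (j%:R * (pi / (2 * n%:R))))) - 1).
Proof.
rewrite /GK_kernel /lagrange_kernel -mulrDl addrACA -mulrDr -big_split/=.
rewrite (eq_bigr (fun j : 'I_n => 2 * (cos (j%:R * cheb_angle n k) *
  (cos (j%:R * t) * cos (j%:R * (pi / (2 * n%:R))))))).
  by rewrite -mulr_sumr; ring.
move=> j _; rewrite [j%:R * (t + _)]mulrDr [j%:R * (t - _)]mulrBr cosD cosB.
by ring.
Qed.

Lemma norm_GK_kernel (R : realType) (n k : nat) (t : R) : (0 < n)%N ->
  `|GK_kernel n k t| <= 6.
Proof.
move=> n0; have n0' : 0 < n%:R :> R by rewrite ltr0n.
have n1 : 1 <= n%:R :> R by rewrite ler1n.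
rewrite GK_kernelE normrM ger0_norm; last by rewrite divr_ge0.
rewrite mulrAC ler_pdivrMr//.
set S := \sum_(j < n) _.
have : `|S| <= n%:R.
  rewrite (le_trans (ler_norm_sum _ _ _))//.
  rewrite -[leRHS](_ : \sum_(j < n) 1 = _); last by rewrite sumr_const card_ord.
  by apply: ler_sum => j _; rewrite !normrM !mulr_ile1 ?mulr_ge0// ?cos_max.
rewrite ler_norml => /andP[S1 S2].
(* As n >= 1, this bound is at most 3 n, and the prefactor 2 / n turns it into 6. *)
suff : `|2 * S - 1| <= 2 * n%:R + 1 by lra.
by rewrite ler_norml; apply/andP; split; lra.
Qed.

(* Summing over k first, the factor cos (j h) coming from the shifts by
   h = pi / (2 n) cancels the denominator of the geometric sum. *)
Lemma alternating_sum_GK_kernel (R : realType) (n : nat) (t : R) : (0 < n)%N ->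
  `|\sum_(1 <= k < n.+1) (-1) ^+ k * GK_kernel n k t| <= 6.
Proof.
move=> n0; have n0' : 0 < n%:R :> R by rewrite ltr0n.
set h := pi / (2 * n%:R) : R.
have -> : \sum_(1 <= k < n.+1) (-1) ^+ k * GK_kernel n k t =
    2 / n%:R * (\sum_(j < n) cos (j%:R * t) *
      ((-1) ^+ n * cos (2 * n%:R * (j%:R * h)) - 1) -
      \sum_(1 <= k < n.+1) (-1) ^+ k).
  under [in RHS]eq_bigr => j _ do rewrite -alternating_sum_cos_odd !mulr_sumr.
  rewrite exchange_big/= -sumrB mulr_sumr; apply: eq_bigr => k _.
  rewrite GK_kernelE -/h mulrCA; congr (_ * _).
  rewrite mulrBr mulr1 !mulr_sumr; congr (_ - _); apply: eq_bigr => j _.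
  have -> : j%:R * cheb_angle n k = (2 * k%:R - 1) * (j%:R * h).
    by rewrite /cheb_angle /h; ring.
  ring.
rewrite normrM ger0_norm; last by rewrite divr_ge0.
rewrite mulrAC ler_pdivrMr//.
set A := \sum_(j < n) _; set B := \sum_(1 <= k < n.+1) _.
have hA : `|A| <= n%:R * 2.
  rewrite (le_trans (ler_norm_sum _ _ _))//.
  rewrite -[leRHS](_ : \sum_(j < n) 2 = _); last first.
    by rewrite sumr_const card_ord mulr_natl.
  apply: ler_sum => j _; rewrite normrM -[leRHS]mul1r ler_pM ?cos_max//.
  rewrite (le_trans (ler_normB _ _))// normr1 normrM normrX normrN1 expr1n mul1r.
  by have := cos_max (2 * n%:R * (j%:R * h)); lra.
have hB : `|B| <= n%:R.
  rewrite (le_trans (ler_norm_sum _ _ _))//.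
  under eq_bigr => k _ do rewrite normrX normrN1 expr1n.
  by rewrite sumr_const_nat subn1.
by have := ler_normB A B; lra.
Qed.

(** * Signs of the kernels and the sum of their absolute values *)

(** Shifting t by h moves n t by pi / 2, so the two numerators carry sin (n t) with opposite signs;
    over the common denominator there remains cos (t - h) - cos (t + h) = 2 sin t sin h. *)
Lemma GK_kernelM (R : realType) (n k : nat) (t : R) : (0 < k <= n)%N ->
  let h := pi / (2 * n%:R) in let x := cheb_angle n k in
  (-1) ^+ k * GK_kernel n k t *
    (n%:R * ((cos h - cos (t - x)) * (cos h - cos (t + x)))) =
  sin x * sin (n%:R * t) * (2 * sin t * sin h).
Proof.
move=> kn h x; have n0 : n%:R != 0 :> R.
  by rewrite pnatr_eq0 -lt0n; case/andP: kn => /leq_trans; exact.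
(* Both sides equal cos^2 h + cos^2 t + cos^2 x - 1 - 2 cos h cos t cos x; on the left the sign of
   each factor can be read off. *)
have prodE : (cos h - cos (t - x)) * (cos h - cos (t + x)) =
    (cos (t + h) - cos x) * (cos (t - h) - cos x).
  have := cos2Dsin2 t; have := cos2Dsin2 x; have := cos2Dsin2 h.
  by rewrite !cosB !cosD; nra.
have nh : n%:R * h = pi / 2 by rewrite /h; field.
have cp : cos (n%:R * (t + h)) = - sin (n%:R * t).
  by rewrite mulrDr nh cosDpihalf.
have cm : cos (n%:R * (t - h)) = sin (n%:R * t).
  by rewrite mulrBr nh cosBpihalf.
have ep := lagrange_kernelM R n k (t + h) kn.
have em := lagrange_kernelM R n k (t - h) kn.
rewrite prodE /GK_kernel -/h -/x in ep em *.
rewrite cp exprS in ep; rewrite cm exprS in em.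
transitivity ((-1) ^+ k * (
   (lagrange_kernel n x (t + h) * (n%:R * (cos (t + h) - cos x))) *
     (cos (t - h) - cos x) +
   (lagrange_kernel n x (t - h) * (n%:R * (cos (t - h) - cos x))) *
     (cos (t + h) - cos x))); first by ring.
rewrite ep em cosB cosD.
have sq : (-1) ^+ k * (-1) ^+ k = 1 :> R.
  by rewrite -exprMn mulrNN mulr1 expr1n.
transitivity ((-1) ^+ k * (-1) ^+ k * (sin x * sin (n%:R * t) *
   (2 * sin t * sin h))); first by ring.
by rewrite sq mul1r.
Qed.

(** Makes both factors in [GK_kernelM] positive. Cosine decreases on [0, pi], which contains |t -
    x|; the sum t + x lies in (h, 2 pi - h) and is reflected about pi when it exceeds pi. *)
Lemma cos_lt_far (R : realType) (h x t : R) : 0 < h -> 0 <= t <= pi ->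
  h <= x <= pi - h -> h < `|t - x| ->
  cos (t - x) < cos h /\ cos (t + x) < cos h.
Proof.
move=> h0 /andP[t0 tpi] /andP[hx xpi] hd.
have hI : h \in `[0, pi] by rewrite in_itv/=; apply/andP; split; lra.
have d1 : `|t - x| <= pi by rewrite ler_norml; apply/andP; split; lra.
split.
  have -> : cos (t - x) = cos `|t - x|.
    have [tx|tx] := lerP 0 (t - x); first by rewrite ger0_norm.
    by rewrite ltr0_norm// cosN.
  by rewrite ltr_cos// in_itv/= normr_ge0.
have [htx htx'] : h < t + x /\ t + x < 2 * pi - h.
  by move: hd; rewrite ltr_normr => /orP[?|?]; split; lra.
case: (lerP (t + x) pi) => tx.
  by rewrite ltr_cos// in_itv/= tx andbT; lra.
have -> : cos (t + x) = cos (2 * pi - (t + x)).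
  by rewrite cosB mulr_natl cos2pi sin2pi; ring.
rewrite ltr_cos//; first by lra.
by rewrite in_itv/=; apply/andP; split; lra.
Qed.

(* As the k-th node is (2 k - 1) h, the hypothesis says that k lies in
   [t / (2 h), t / (2 h) + 1]. *)
Lemma cheb_angle_near (R : realType) (n k : nat) (t : R) : (0 < n)%N ->
  0 <= t -> let h := pi / (2 * n%:R) in let m := Num.trunc (t / (2 * h)) in
  `|t - cheb_angle n k| <= h -> (k == m) || (k == m.+1).
Proof.
move=> n0 t0 h m; have n0' : 0 < n%:R :> R by rewrite ltr0n.
have h0 : 0 < h by rewrite divr_gt0 ?pi_gt0// mulr_gt0.
have -> : cheb_angle n k = (2 * k%:R - 1) * h by rewrite /cheb_angle /h; ring.
have y0 : 0 <= t / (2 * h) by rewrite divr_ge0//; lra.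
have /andP[] := truncn_itv y0; rewrite -/m.
set y := t / (2 * h) in y0 *; have -> : t = y * (2 * h).
  by rewrite /y; field; rewrite gt_eqF.
move=> my ym; rewrite ler_norml => /andP[h1 h2].
have ky : y <= k%:R by nra.
have yk : k%:R <= y + 1 by nra.
have mk : (m < k.+1)%N by rewrite -(ltr_nat R) -[k.+1%:R]natr1; lra.
have km : (k < m.+2)%N.
  by rewrite -(ltr_nat R) -[m.+2%:R]natr1; lra.
by clear -mk km; lia.
Qed.

(** The constant is 6 + 12 * 2: 6 for the alternating sum and 12 for each of at most two exceptional
    nodes. *)
Lemma sum_norm_GK_kernel (R : realType) (n : nat) (t : R) : (0 < n)%N ->
  0 <= t <= pi -> \sum_(1 <= k < n.+1) `|GK_kernel n k t| <= 30.
Proof.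
move=> n0 /andP[t0 tpi]; have n0' : 0 < n%:R :> R by rewrite ltr0n.
set h := pi / (2 * n%:R) : R.
have h0 : 0 < h by rewrite divr_gt0 ?pi_gt0// mulr_gt0.
have hpi : h < pi.
  rewrite /h ltr_pdivrMr ?mulr_gt0// -[ltLHS]mulr1 ltr_pM2l ?pi_gt0//.
  have : 1 <= n%:R :> R by rewrite ler1n.
  lra.
set m := Num.trunc (t / (2 * h)).
(* Marks the only candidates for nodes within h of t; either may fall outside 1..n, which only
   lowers the sum of [e]. *)
pose e (k : nat) : R := (k == m)%:R + (k == m.+1)%:R.
(* A sign of sin (n t) that is 1 at zero, so that |s| = 1 always. *)
pose s : R := if 0 <= sin (n%:R * t) then 1 else -1.
have s1 : `|s| = 1 by rewrite /s; case: ifP; rewrite ?normrN normr1.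
have ss : 0 <= s * sin (n%:R * t).
  by rewrite /s; have [?|?] := lerP 0 (sin (n%:R * t)); lra.
have key k : (1 <= k < n.+1)%N ->
    `|GK_kernel n k t| <= s * ((-1) ^+ k * GK_kernel n k t) + 12 * e k.
  rewrite ltnS => kn; set T := GK_kernel n k t.
  have nT : `|s * ((-1) ^+ k * T)| = `|T|.
    by rewrite !normrM s1 normrX normrN1 expr1n !mul1r.
  have e0 : 0 <= e k by rewrite addr_ge0.
  case: (lerP `|t - cheb_angle n k| h) => [near_k|far_k].
    have e1 : 1 <= e k.
      have /orP[] := cheb_angle_near R n k t n0 t0 near_k; rewrite -/h -/m /e => ->.
        by rewrite lerDl.
      by rewrite lerDr.
    have : `|T| <= 6 by exact: norm_GK_kernel.
    (* The signed value may be -|T|; the gap 2 |T| is at most 12. *)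
    by have := lerNnormlW (lexx `|s * ((-1) ^+ k * T)|); rewrite nT; lra.
  have kx := cheb_angle_itv R n k kn.
  have [c1 c2] := cos_lt_far R h _ t h0 (introT andP (conj t0 tpi)) kx far_k.
  have := GK_kernelM R n k t kn; rewrite /= -/h -/T => TM.
  suff : 0 <= s * ((-1) ^+ k * T).
    by move=> /ger0_norm; rewrite nT => ->; lra.
  have p0 : 0 < n%:R * ((cos h - cos (t - cheb_angle n k)) *
      (cos h - cos (t + cheb_angle n k))) by rewrite !mulr_gt0// subr_gt0.
  rewrite -(pmulr_lge0 _ p0) -mulrA TM.
  have -> : forall a b c : R, s * (a * b * c) = a * (s * b) * c.
    by move=> a b c; ring.
  have sx := sin_cheb_angle_gt0 R n k kn.
  have st : 0 <= sin t by apply: sin_ge0_pi; rewrite t0.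
  have sh : 0 < sin h by apply: sin_gt0_pi; rewrite h0.
  apply: mulr_ge0; first by rewrite mulr_ge0// ltW.
  by rewrite mulr_ge0 ?(ltW sh)// mulr_ge0.
rewrite (le_trans (ler_sum_nat key))//.
rewrite big_split/= -!mulr_sumr.
have sumI (j : nat) : \sum_(1 <= k < n.+1) (k == j)%:R <= 1 :> R.
  rewrite -natr_sum lern1.
  have -> : (\sum_(1 <= k < n.+1) (k == j) = count_mem j (index_iota 1 n.+1))%N.
    rewrite -sum1_count [RHS]big_mkcond/=.
    by apply: eq_bigr => k _; case: eqP.
  by rewrite count_uniq_mem ?iota_uniq// leq_b1.
have := alternating_sum_GK_kernel R n t n0.
set A := \sum_(1 <= k < n.+1) _ * _ => hA.
have sA : s * A <= 6.
  by rewrite (le_trans (ler_norm _))// normrM s1 mul1r.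
rewrite /e big_split/=.
by have := sumI m; have := sumI m.+1; lra.
Qed.

(** * Bound for the operators *)

Lemma GKE (R : realType) (n : nat) (f : R -> R) (t : R) :
  GK n f t = n%:R / pi *
    \sum_(1 <= k < n.+1)
      (\int[lebesgue_measure]_(u in
          `[cheb_angle n k, (cheb_angle n k + pi / (2 * n%:R))%R]) f u) *
      GK_kernel n k t.
Proof. by congr (_ * _); apply: eq_big_nat => k kn; rewrite !P_funE. Qed.

(** The integrals are constants in the variable, which leaves a finite combination of shifted cosine
    polynomials. *)
Lemma continuous_GK (R : realType) (n : nat) (f : R -> R) : continuous (GK n f).
Proof.
move=> t; rewrite (funext (GKE R n f)).
apply: cvgMr; apply: cvg_big => [|k _]; first exact: add_continuous.
apply: cvgMr; apply: cvgD.
  apply: (@continuous_comp _ _ _ (+%R^~ (pi / (2 * n%:R)))).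
    by apply: cvgD; [exact: cvg_id|exact: cvg_cst].
  exact: continuous_lagrange_kernel.
apply: (@continuous_comp _ _ _ (+%R^~ (- (pi / (2 * n%:R))))).
  by apply: cvgD; [exact: cvg_id|exact: cvg_cst].
exact: continuous_lagrange_kernel.
Qed.

(** Each integral is at most M h in absolute value, the kernels contribute 30, and (n / pi) h = 1 /
    2; hence 15. *)
Lemma norm_GK_le (R : realType) (n : nat) (f : R -> R) (M t : R) :
  (0 < n)%N -> {within `[0, pi], continuous f} ->
  (forall u, u \in `[0, pi] -> `|f u| <= M) -> t \in `[0, pi] ->
  `|GK n f t| <= 15 * M.
Proof.
move=> n0 cf fM; rewrite in_itv/= => tI; have n0' : 0 < n%:R :> R by rewrite ltr0n.
have pi0 := pi_gt0 R.
set h := pi / (2 * n%:R) : R.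
have h0 : 0 < h by rewrite divr_gt0// mulr_gt0.
have M0 : 0 <= M.
  by apply: le_trans (fM 0 _); rewrite ?normr_ge0// in_itv/= lexx ltW.
have intM k : (1 <= k < n.+1)%N ->
    `|\int[lebesgue_measure]_(u in
        `[cheb_angle n k, (cheb_angle n k + h)%R]) f u| <= M * h.
  rewrite ltnS => kn; have /andP[kh kpi] := cheb_angle_itv R n k kn.
  rewrite -/h in kh kpi; set a := cheb_angle n k in kh kpi *.
  (* The last node is at most pi - h, so the interval stays where [f] is continuous and bounded by
     [M]. *)
  have sub : `[a, (a + h)%R] `<=` `[0, pi : R].
    by move=> u /=; rewrite !in_itv/= => /andP[? ?]; apply/andP; split; lra.
  have ifun : lebesgue_measure.-integrable `[a, (a + h)%R] (EFin \o f).
    apply: continuous_compact_integrable; first exact: segment_compact.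
    exact: continuous_subspaceW sub cf.
  rewrite (le_trans (le_normr_Rintegral _ ifun))//.
  have icst : lebesgue_measure.-integrable `[a, (a + h)%R] (EFin \o cst M).
    apply: continuous_compact_integrable; first exact: segment_compact.
    by apply: continuous_subspaceT => ?; exact: cvg_cst.
  apply: le_trans (le_Rintegral (f2 := cst M) _ _ icst _) _ => //.
  - exact: integrable_norm.
  - by move=> u /sub; exact: fM.
  rewrite /cst Rintegral_cst//= lebesgue_measure_itv/= lte_fin.
  by rewrite ltrDl h0 -EFinB/= addrAC subrr add0r.
rewrite GKE normrM ger0_norm; last by rewrite divr_ge0//; lra.
have scaleE (p q : R) : p != 0 -> q != 0 ->
    15 * M = q / p * (M * (p / (2 * q)) * 30).
  by move=> p_neq0 q_neq0; field; rewrite p_neq0 q_neq0.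
rewrite (scaleE pi n%:R) ?gt_eqF// -/h.
rewrite ler_pM2l ?divr_gt0//.
rewrite (le_trans (ler_norm_sum _ _ _))//.
rewrite (@le_trans _ _ (\sum_(1 <= k < n.+1) M * h * `|GK_kernel n k t|))//.
  apply: ler_sum_nat => k kn; rewrite normrM ler_pM ?intM//.
by rewrite -mulr_sumr ler_wpM2l ?sum_norm_GK_kernel// mulr_ge0// ltW.
Qed.

Theorem lemma2p3 (R : realType) :
  exists C : R, 0 < C /\
    forall (n : nat) (f : R -> R), (0 < n)%N ->
      {within `[0, pi], continuous f} ->
      {within `[0, pi], continuous (GK n f)} /\
      (supnorm (GK n f) <= C%:E * supnorm f)%E.
Proof.
exists 15; split=> // n f n0 cf; split.
  by apply: continuous_subspaceT; exact: continuous_GK.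
have lef u : u \in `[0, pi] -> (`|f u|%:E <= supnorm f)%E.
  by move=> uI; apply: ereal_sup_ubound; exists u.
apply: ge_ereal_sup => _ [t /= tI <-].
(* The value +oo makes the bound trivial, and -oo is excluded by the value of [f] at [t]. *)
case: (supnorm f) lef => [M|_|lef].
- move=> lef; rewrite -EFinM lee_fin; apply: (norm_GK_le _ _ _ _ _ n0 cf _ tI) => u uI.
  by have := lef u uI; rewrite lee_fin.
- by rewrite gt0_muley ?lte_fin// leey.
- by have := lef t tI; rewrite leNgt ltNyr.
Qed.
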